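(* Let $D$ be a lock diagram with nonempty rows $r_1<r_2<\dots<r_n$. Suppose that there is at most one index $k$ with $r_k>k$ such that row $r_k$ of $\mathsf{snow}(D)$ contains no dark cloud. Then $\mathrm{MaxG}(D)$ equals the number of snowflakes in $\mathsf{snow}^*(D)$.
   Context: A diagram is a finite set of cells at positions $(r,c)$ with $r,c$ positive integers ($r$ = row from the bottom, $c$ = column), at most one cell per position; each cell is either ordinary, written $(r,c)$, or a ghost cell, written $\langle r,c\rangle$. A position is empty if it contains no cell. K-Kohnert move at row $r$ of $D$: let the rightmost cell of row $r$ (ghost or not) lie in column $c$. The move does nothing if that cell is a ghost cell, or every position $(r',c)$ with $r'<r$ is occupied, or, letting $\hat r<r$ be maximal with $(\hat r,c)$ empty, some $(r^*,c)$ with $\hat r<r^*<r$ holds a ghost cell. Otherwise there are two choices: the Kohnert move moves the cell from $(r,c)$ to $(\hat r,c)$; the ghost move does the same and additionally places a ghost cell $\langle r,c\rangle$ at $(r,c)$. $KKD(D)$ is the set of $D$ and all diagrams obtained from $D$ by finite sequences of K-Kohnert moves; $\mathrm{MaxG}(D)$ is the maximum number of ghost cells in a diagram of $KKD(D)$. Snow diagram $\mathsf{snow}(D)$: for $D$ with no ghost cells, process rows from top to bottom; in each row mark the rightmost cell of that row with no already-marked cell above it in its column (if any); marked cells are dark clouds. Place a snowflake in each empty position strictly below a dark cloud in the same column. $\mathsf{snow}^*(D)$ is obtained from $\mathsf{snow}(D)$ by removing all snowflakes lying in rows that are nonempty in $D$. Lock diagram: for a weak composition $\alpha=(\alpha_1,\dots,\alpha_n)\in\mathbb{Z}_{\ge0}^n$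 with $N=\max_i\alpha_i$, the lock diagram is $\bigcup_{i=1}^n\{(i,N-j):0\le j\le\alpha_i-1\}$ (ordinary cells; row $i$ has $\alpha_i$ cells right-justified ending in column $N$). *)

(* Defs.v *)
From HB Require Import structures.
From mathcomp Require Import all_boot finmap.

Set Implicit Arguments.
Unset Strict Implicit.
Unset Printing Implicit Defensive.

Local Open Scope nat_scope.
Local Open Scope fset_scope.
Local Open Scope fmap_scope.

Inductive cell := Ordinary | Ghost.

Definition is_ghost (x : cell) : bool := if x is Ghost then true else false.
Definition cell_of_bool (b : bool) : cell := if b then Ghost else Ordinary.

Lemma is_ghostK : cancel is_ghost cell_of_bool.
Proof. by case. Qed.

HB.instance Definition _ := Countable.copy cell (can_type is_ghostK).

(* Positions are pairs (row, column); rows and columns are counted from 1.  *)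
(* Lock diagrams have only positive coordinates, and moves preserve this.   *)
Definition pos : Type := (nat * nat)%type.

(* A finite map gives at most one cell, ordinary or ghost, per position.    *)
Definition diagram : Type := {fmap pos -> cell}.

Definition rightmost (D : diagram) (r c : nat) : Prop :=
  (r, c) \in D /\ forall c', (r, c') \in D -> c' <= c.

(* rh is the maximal row 1 <= rh < r such that (rh, c) is empty. *)
Definition landing_row (D : diagram) (r c rh : nat) : Prop :=
  [/\ 0 < rh < r, (rh, c) \notin D
    & forall r', rh < r' < r -> (r', c) \in D].

Definition can_move (D : diagram) (r c rh : nat) : Prop :=
  [/\ rightmost D r c, D.[? (r, c)] <> Some Ghost, landing_row D r c rh
    & forall r', rh < r' < r -> D.[? (r', c)] <> Some Ghost].

Inductive KKohnert_move (D : diagram) : diagram -> Prop :=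
| Kohnert_move r c rh : can_move D r c rh ->
    KKohnert_move D (D.[~ (r, c)]).[(rh, c) <- Ordinary]
| Ghost_move r c rh : can_move D r c rh ->
    KKohnert_move D (D.[(r, c) <- Ghost]).[(rh, c) <- Ordinary].

Inductive KKD (D : diagram) : diagram -> Prop :=
| KKD_refl : KKD D D
| KKD_step E F : KKD D E -> KKohnert_move E F -> KKD D F.

Definition ghosts (D : diagram) : {fset pos} :=
  [fset p in domf D | D.[? p] == Some Ghost].

(* MaxG(D) = m *)
Definition is_MaxG (D : diagram) (m : nat) : Prop :=
  (exists2 E, KKD D E & #|` ghosts E | = m)
  /\ (forall E, KKD D E -> #|` ghosts E | <= m).

Definition row_columns (D : diagram) (r : nat) : seq nat :=
  [seq p.2 | p <- domf D & p.1 == r].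

Definition row_nonempty (D : diagram) (r : nat) : bool :=
  row_columns D r != [::].

Definition height (D : diagram) : nat := \max_(p <- domf D) p.1.

(* Dark clouds: S is the set of cells marked in the rows above row r. *)
Definition mark_row (D : diagram) (r : nat) (S : {fset pos}) : {fset pos} :=
  let cand := [seq c <- row_columns D r
                 | ~~ has (fun p : pos => (r < p.1) && (p.2 == c)) S] in
  if cand is [::] then S else (r, \max_(c <- cand) c) |` S.

(* foldr starts from the last element of the list, i.e. from the top row. *)
Definition mark_dark_clouds (D : diagram) : {fset pos} :=
  foldr (mark_row D) fset0 (iota 1 (height D)).

Definition place_snowflakes (D : diagram) : {fset pos} :=
  [fset p in [seq (r, q.2) | q <- mark_dark_clouds D, r <- iota 1 q.1.-1]
     | p \notin D].

Record snow_diagram := SnowDiagram {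
  snow_cells : diagram;
  dark_clouds : {fset pos};
  snowflakes : {fset pos}
}.

(* Meaningful for diagrams without ghost cells. *)
Definition snow (D : diagram) : snow_diagram :=
  SnowDiagram D (mark_dark_clouds D) (place_snowflakes D).

Definition snow_star (D : diagram) : snow_diagram :=
  SnowDiagram D (dark_clouds (snow D))
    [fset p in snowflakes (snow D) | ~~ row_nonempty D p.1].

(* alpha_i is nth 0 alpha i.-1. *)
Definition lock_positions (alpha : seq nat) : {fset pos} :=
  let N := \max_(a <- alpha) a in
  [fset p in [seq (i, N - j) | i <- iota 1 (size alpha),
                               j <- iota 0 (nth 0 alpha i.-1)]].

Definition lock (alpha : seq nat) : diagram :=
  [fmap p : lock_positions alpha => Ordinary].

Definition is_lock (D : diagram) : Prop := exists alpha, D = lock alpha.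

(* Main.v *)
Require Import Defs.
From mathcomp Require Import all_boot finmap zify.

(* Follow each ordinary cell by the row [x] it started in; within a column the
   order is preserved, and from left to right the cells labelled [x] weakly
   descend.  Give a ghost in row [s] the label [x] of the cell that left it.
   Then [rank x < s <= x], where [rank x] is the number of nonempty rows up to
   [x], and the ghosts inject into such pairs [(x, s)].  If [x] is the only
   label above its rank without a dark cloud, each ghost [(x, s)] forces a
   ghostless pair on the diagonal above [(x, s)], so the ghosts still inject
   into the pairs with [x] dark; there are as many of these as snowflakes in
   [snow_star].  The bound is attained by lowering each row [x] to row
   [rank x], bottom row first. *)

Set Implicit Arguments.
Unset Strict Implicit.
Unset Printing Implicit Defensive.

Local Open Scope fset_scope.
Local Open Scope fmap_scope.
Local Open Scope nat_scope.

(** * Cell lookups and the shape of a lock diagram *)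

Lemma mem_lookup (E : diagram) (q : pos) : (q \in E) = (E.[? q] != None).
Proof. by rewrite -fndSome; case: (E.[? q]). Qed.

Lemma mem_ghosts (E : diagram) (q : pos) :
  (q \in ghosts E) = (E.[? q] == Some Ghost).
Proof.
rewrite /ghosts !inE /= andbC; case: eqP => //= Eq.
by rewrite -/(q \in E) mem_lookup Eq.
Qed.

Lemma lookup_ordinary (E : diagram) (q : pos) :
  q \in E -> E.[? q] <> Some Ghost -> E.[? q] = Some Ordinary.
Proof. by rewrite mem_lookup; case: (E.[? q]) => // -[]. Qed.

(** [A] extends the row lengths by zero to all of [nat], so no later argument has to mention the
    composition or its size. *)
Record lock_shape (D : diagram) (N : nat) (A : nat -> nat) : Prop := LockShape {
  shape_row0 : A 0 = 0;
  shape_le : forall x, A x <= N;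
  shape_mem : forall x c, ((x, c) \in D) = (N - A x < c <= N);
  shape_ordinary : forall q, D.[? q] <> Some Ghost
}.

Lemma lock_shapeP (D : diagram) : is_lock D -> exists N A, lock_shape D N A.
Proof.
case=> alpha ->; set N := \max_(a <- alpha) a.
have leN i : nth 0 alpha i <= N.
  case: (ltnP i (size alpha)) => [lti|lei]; last by rewrite nth_default.
  exact: leq_bigmax_seq _ (mem_nth 0 lti) _.
exists N, (fun x => if x is x'.+1 then nth 0 alpha x' else 0); split=> //.
- by case.
- move=> x c; rewrite -[_ \in _]/((x, c) \in lock_positions alpha).
  rewrite /lock_positions -/N in_fset /=.
  apply/allpairsPdep/idP => [[i [j []]]|].
    rewrite !mem_iota => /andP[]; case: i => // i _ _ ltj [-> ->].
    by have := leN i; move: ltj => /=; lia.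
  case: x => [|x]; first by lia.
  move=> lec; exists x.+1, (N - c); rewrite !mem_iota /=; split; last 1 first.
  - by congr pair; lia.
  - case: (ltnP x (size alpha)) => [|lei]; first by lia.
    by move: lec; rewrite nth_default //; lia.
  - by have := leN x; lia.
- by move=> q; case: fndP => // qD; rewrite ffunE.
Qed.

Lemma shape_right (D : diagram) N A x c c' :
  lock_shape D N A -> (x, c) \in D -> c <= c' <= N -> (x, c') \in D.
Proof. by move=> sD; rewrite !(shape_mem sD); lia. Qed.

(** * Labels carried along K-Kohnert moves *)

Definition after_move (E F : diagram) (r c rh : nat) (g : bool) : Prop :=
  forall q, F.[? q] = if q == (rh, c) then Some Ordinary
    else if q == (r, c) then (if g then Some Ghost else None) else E.[? q].

Lemma Kohnert_moveP (E F : diagram) : KKohnert_move E F ->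
  exists r c rh g, can_move E r c rh /\ after_move E F r c rh g.
Proof.
case=> r c rh mv; exists r, c, rh.
  by exists false; split=> // q; rewrite fnd_set fnd_rem1; case: eqP => //; case: eqP.
by exists true; split=> // q; rewrite !fnd_set.
Qed.

(* [p x c] is the current row of the cell of column [c] that started in row
   [x]: a cell jumping over a run of cells is read as pushing the run down by
   one, so that the order in each column is preserved.  [l] sends a ghost to
   the starting row of the cell that left it behind. *)
Record labelling (D : diagram) (N : nat) (E : diagram)
    (p : nat -> nat -> nat) (l : pos -> nat) : Prop := Labelling {
  label_cell : forall s c, E.[? (s, c)] = Some Ordinary <->
    exists2 x, (x, c) \in D & p x c = s;
  label_lt : forall x y c, (x, c) \in D -> (y, c) \in D -> x < y ->
    p x c < p y c;
  label_right : forall x c c', (x, c) \in D -> c <= c' <= N ->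
    p x c' <= p x c;
  label_bounds : forall x c, (x, c) \in D -> 0 < p x c <= x;
  ghost_label : forall s c, E.[? (s, c)] = Some Ghost ->
    [/\ (l (s, c), c) \in D, s <= l (s, c)
      & forall c', c <= c' <= N -> p (l (s, c)) c' < s];
  ghost_inj : forall s c c', E.[? (s, c)] = Some Ghost ->
    E.[? (s, c')] = Some Ghost -> l (s, c) = l (s, c') -> c = c';
  ghost_above : forall s c y, E.[? (s, c)] = Some Ghost -> (y, c) \in D ->
    l (s, c) < y -> s < p y c
}.

(** There are no ghosts yet, so the constant ghost label is arbitrary. *)
Lemma labelling_start (D : diagram) N A : lock_shape D N A ->
  labelling D N D (fun x _ => x) (fun => 0).
Proof.
move=> sD; split=> //; try by move=> s c /(shape_ordinary sD).
- move=> s c; split=> [Ds|[x Dx <-]]; last first.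
    exact: lookup_ordinary Dx (shape_ordinary sD (q := _)).
  by exists s => //; rewrite mem_lookup Ds.
- move=> x c; rewrite (shape_mem sD) leqnn andbT.
  by case: x => //; rewrite (shape_row0 sD); lia.
- by move=> s c c' /(shape_ordinary sD).
- by move=> s c y /(shape_ordinary sD).
Qed.

(** Only the labels lying in rows [rh.+1] to [r] of column [c] change, each going down by one.
    Strict order in the column survives because row [rh] was free, and weak descent to the right
    because of [run_right]. *)
Lemma labelling_move (D : diagram) N A (E F : diagram) p l r c rh g :
  lock_shape D N A -> labelling D N E p l ->
  can_move E r c rh -> after_move E F r c rh g ->
  exists p' l', labelling D N F p' l'.
Proof.
move=> sD lab [[rcE rmax] rcG [/andP[rh0 rhr] rhE run] runG] EF.
have col s : E.[? (s, c)] <> None -> s <> rh.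
  by move=> + s_rh; move: rhE; rewrite s_rh mem_lookup negbK => /eqP ->.
have run_ord s : rh < s <= r -> exists2 x, (x, c) \in D & p x c = s.
  move=> /andP[rhs]; rewrite leq_eqVlt => sr; apply/(label_cell lab).
  case/orP: sr => [/eqP->|sr]; first exact: lookup_ordinary.
  by apply: lookup_ordinary (run _ _) (runG _ _); rewrite rhs.
have cN : c <= N.
  have [x xD _] : exists2 x, (x, c) \in D & p x c = r by apply: run_ord; lia.
  by move: xD; rewrite (shape_mem sD) => /andP[].
have not_rh x : (x, c) \in D -> p x c <> rh.
  by move=> xD; apply: col; rewrite (proj2 (label_cell lab _ _)) //; exists x.
have pinj x y : (x, c) \in D -> (y, c) \in D -> p x c = p y c -> x = y.
  move=> xD yD pxy; case: (ltngtP x y) => // [/(label_lt lab xD yD)|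
    /(label_lt lab yD xD)]; lia.
(* A label of the run lying in the same row in a column further to the right
   would force the next label of the run to do so, up to row [r], which is
   empty to the right of [c]. *)
have run_right x c' : (x, c) \in D -> rh < p x c <= r -> c < c' <= N ->
    p x c' < p x c.
  move=> + + cc'; move mE: (r - p x c) => m.
  elim: m x mE => [|m IHm] x mE xD runx.
    have lex : p x c' <= p x c by apply: (label_right lab) => //; lia.
    rewrite ltn_neqAle lex andbT; apply/eqP => eqx.
    have : (r, c') \in E.
      rewrite mem_lookup (proj2 (label_cell lab _ _)) //.
      by exists x; [apply: shape_right sD xD _; lia | lia].
    by move/rmax; lia.
  have [y yD py] : exists2 y, (y, c) \in D & p y c = (p x c).+1.
    by apply: run_ord; lia.
  have xy : x < y.
    by case: (ltngtP x y) => // [/(label_lt lab yD xD)|eqxy];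
      [|move: py; rewrite eqxy]; lia.
  have ltc : p y c' < p y c by apply: IHm => //; lia.
  have := label_lt lab (shape_right sD xD _) (shape_right sD yD _) xy.
  by move=> /(_ c'); lia.
pose p' x c' := if (c' == c) && (rh < p x c' <= r) then (p x c').-1 else p x c'.
have p'le x c' : p' x c' <= p x c' by rewrite /p'; case: ifP; lia.
have p'other x c' : c' != c -> p' x c' = p x c' by rewrite /p' => /negPf->.
have p'c x : p' x c = if rh < p x c <= r then (p x c).-1 else p x c.
  by rewrite /p' eqxx.
have [top topD ptop] : exists2 x, (x, c) \in D & p x c = r by apply: run_ord; lia.
(* A new ghost takes the label at the top of the run. After a Kohnert move [(r, c)] is empty, and
   the new value there is harmless. *)
pose l' q := if q == (r, c) then top else l q.
(* In column [c] the old ghosts avoid rows [rh] to [r]: the landing position is empty and the run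
   holds none. *)
have oldG s c' : F.[? (s, c')] = Some Ghost -> (s, c') <> (r, c) ->
    [/\ E.[? (s, c')] = Some Ghost, l' (s, c') = l (s, c') &
        c' = c -> ~~ (rh <= s <= r)].
  rewrite EF /l'; case: eqP => // ne1; case: eqP => // ne2 Es _; split=> // eqc.
  move: ne1 ne2 Es; rewrite eqc => ne1 ne2 Es.
  apply/negP => /andP[rhs sr]; apply: (runG s) => //.
  by apply/andP; split; rewrite ltn_neqAle ?rhs ?sr andbT; apply/eqP => eqs;
    [case: ne1; rewrite eqs | case: ne2; rewrite eqs].
exists p', l'; split.
- move=> s c'; rewrite EF; case: (eqVneq c' c) => [->|ne]; last first.
    rewrite !xpair_eqE (negPf ne) !andbF; split=> [/(label_cell lab)|] [x xD px].
      by exists x; rewrite ?p'other.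
    by apply/(label_cell lab); exists x; rewrite // -px p'other.
  rewrite !xpair_eqE eqxx !andbT; split=> [|[x xD]].
    case: (eqVneq s rh) => [-> _|ne].
      have [x xD px] : exists2 x, (x, c) \in D & p x c = rh.+1.
        by apply: run_ord; lia.
      by exists x; rewrite // p'c px; case: ifP; lia.
    case: (eqVneq s r) => [_|ner]; first by case: (g).
    case: (boolP (rh < s < r)) => [runs _|nrun].
      have [x xD px] : exists2 x, (x, c) \in D & p x c = s.+1.
        by apply: run_ord; lia.
      by exists x; rewrite // p'c px; case: ifP; lia.
    case/(label_cell lab) => x xD px; exists x; rewrite // p'c px.
    by case: ifP; lia.
  rewrite p'c => ps; case: (eqVneq s rh) => // ne.
  have ner : s != r.
    by apply/eqP => sr; move: ps; case: ifP; lia.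
  rewrite (negPf ner).
  have [in_run|not_run] := boolP (rh < s < r).
    by apply/(label_cell lab)/run_ord; lia.
  apply/(label_cell lab); exists x => //; move: ps; case: ifP; lia.
- move=> x y c' xD yD xy; have := label_lt lab xD yD xy.
  case: (eqVneq c' c) => [eqc|ne]; last by rewrite !p'other.
  move: xD yD; rewrite eqc !p'c => xD yD.
  by have := not_rh x xD; have := not_rh y yD; do 2!case: ifP; lia.
- move=> x c1 c2 xD c12; have le12 := label_right lab xD c12.
  case: (eqVneq c1 c) => [eqc|ne]; last by rewrite (p'other x c1) //; apply: leq_trans le12.
  case: (eqVneq c2 c) => [->|ne2]; first by rewrite eqc.
  rewrite p'other // eqc p'c; move: xD c12 le12; rewrite eqc => xD c12 le12.
  case: ifP => // runx; have := run_right x c2 xD runx; lia.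
- move=> x c' xD; have := label_bounds lab xD; rewrite /p'; case: ifP; lia.
- move=> s c' Fs; case: (eqVneq (s, c') (r, c)) => [[-> ->]|/eqP ne].
    rewrite /l' eqxx; split=> //.
      by have := label_bounds lab topD; lia.
    move=> c2 c2N; have := p'le top c2; case: (eqVneq c2 c) => [->|ne2].
      by rewrite p'c ptop; case: ifP; lia.
    have : p top c2 < p top c by apply: run_right => //; lia.
    by lia.
  have [Es -> _] := oldG s c' Fs ne; have [lD sl lts] := ghost_label lab Es.
  by split=> // c2 /lts; apply: leq_ltn_trans.
(* An old ghost of row [r] labelled [top] would lie left of the rightmost column [c], and
   [ghost_label] would then put [p top c] below [r]. *)
- have aux s c1 c2 : (s, c1) = (r, c) -> (s, c2) <> (r, c) ->
      F.[? (s, c2)] = Some Ghost -> l' (s, c1) <> l' (s, c2).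
    move=> [-> ->] ne F2; have [E2 -> _] := oldG _ _ F2 ne.
    rewrite /l' eqxx => eqtop; have [lD _ lts] := ghost_label lab E2.
    have : c2 <= c by apply: rmax; rewrite mem_lookup E2.
    by have := lts c; rewrite -eqtop ptop; lia.
  move=> s c1 c2 F1 F2 l12.
  case: (eqVneq (s, c1) (r, c)) => [e1|/eqP ne1];
    case: (eqVneq (s, c2) (r, c)) => [e2|/eqP ne2].
  + by case: e1 e2 => _ -> [_ ->].
  + by case: (aux s c1 c2).
  + by case: (aux s c2 c1).
  + have [E1 l1 _] := oldG _ _ F1 ne1; have [E2 l2 _] := oldG _ _ F2 ne2.
    by apply: (ghost_inj lab) E1 E2 _; rewrite -l1 -l2.
- move=> s c' y Fs yD; case: (eqVneq (s, c') (r, c)) => [[? ?]|/eqP ne].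
    subst s c'; rewrite /l' eqxx => /(label_lt lab topD yD).
    by rewrite ptop p'c; case: ifP; lia.
  (* If the cell of [y] is in the run, the ghost under it lies below row [rh], hence still below the
     cell after the shift. *)
  have [Es -> notrun] := oldG s c' Fs ne => /(ghost_above lab Es yD).
  case: (eqVneq c' c) => [eqc|ne']; last by rewrite p'other.
  by move: (notrun eqc); rewrite eqc p'c; case: ifP; lia.
Qed.

Lemma labelling_KKD (D : diagram) N A (E : diagram) :
  lock_shape D N A -> KKD D E -> exists p l, labelling D N E p l.
Proof.
move=> sD; elim=> [|F G _ [p [l lab]] /Kohnert_moveP[r [c [rh [g [mv FG]]]]]].
  by do 2!eexists; apply: labelling_start sD.
exact: labelling_move sD lab mv FG.
Qed.

(** * Ranks, dark clouds and the number of snowflakes *)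

Definition rank (A : nat -> nat) (x : nat) : nat :=
  count (fun y => 0 < A y) (iota 1 x).

(** The number of dark clouds in rows [x.+1] to [h]. [foldr] starts from row [h], and a row adds a
    cloud when it is longer than the count so far. *)
Definition clouds_above (A : nat -> nat) (h x : nat) : nat :=
  foldr (fun y m => m + (m < A y)) 0 (iota x.+1 (h - x)).

(* In a lock diagram the marked columns always form a right-justified
   interval, so a row has a dark cloud iff it is longer than that interval. *)
Definition dark (A : nat -> nat) (h x : nat) : bool := clouds_above A h x < A x.

Definition dark_rows (A : nat -> nat) (h : nat) : seq nat :=
  [seq x <- iota 1 h | dark A h x].

(** For nonempty [x] the summand counts the empty rows below [x], and also the rows [s] with
    [rank A x < s <= x]; this links snowflakes to ghosts. *)
Definition dark_weight (A : nat -> nat) (h : nat) : nat :=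
  sumn [seq x - rank A x | x <- dark_rows A h].

Lemma rankS A x : rank A x.+1 = rank A x + (0 < A x.+1).
Proof. by rewrite /rank -[in LHS](addn1 x) iotaD count_cat /= add1n !addn0. Qed.

Lemma rank_le A x : rank A x <= x.
Proof. by rewrite -[leqRHS](size_iota 1) count_size. Qed.

Lemma count_empty_rows A x : 0 < A x ->
  count (fun s => A s == 0) (iota 1 x.-1) = x - rank A x.
Proof.
case: x => [|x] Ax /=; first by [].
have := count_predC (fun y => 0 < A y) (iota 1 x).
rewrite size_iota rankS Ax -/(rank A x) => eqx.
rewrite (eq_count (a2 := predC (fun y => 0 < A y))); first by lia.
by move=> y /=; lia.
Qed.

Lemma clouds_above_top A h : clouds_above A h h = 0.
Proof. by rewrite /clouds_above subnn. Qed.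

Lemma clouds_aboveS A h x : x < h ->
  clouds_above A h x = clouds_above A h x.+1 + dark A h x.+1.
Proof. by move=> ltxh; rewrite /dark /clouds_above -(subnSK ltxh). Qed.

Lemma clouds_above_anti A h x y : x <= y <= h ->
  clouds_above A h y <= clouds_above A h x.
Proof.
move=> /andP[]; elim: y => [|y IHy]; first by rewrite leqn0 => /eqP->.
rewrite leq_eqVlt => /predU1P[-> //|ltxy] ltyh.
by have := IHy ltxy (ltnW ltyh); rewrite clouds_aboveS //; lia.
Qed.

Lemma clouds_above_lt A h x y : x < y <= h -> dark A h y ->
  clouds_above A h y < clouds_above A h x.
Proof.
case: y => // y /andP[xy yh] dy.
by have := @clouds_above_anti A h x y; rewrite (clouds_aboveS A yh) dy; lia.
Qed.

Lemma clouds_above_le A h x N : (forall y, A y <= N) -> clouds_above A h x <= N.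
Proof.
move=> leN; rewrite /clouds_above; elim: iota => //= y s; case: ltnP => /=; last by lia.
by have := leN y; lia.
Qed.

Lemma mem_row_columns (D : diagram) x c :
  (c \in row_columns D x) = ((x, c) \in D).
Proof.
apply/mapP/idP => [[[x' c']]|xD].
  by rewrite mem_filter /= => /andP[/eqP-> ? ->].
by exists (x, c); rewrite // mem_filter eqxx.
Qed.

Lemma row_nonempty_shape (D : diagram) N A x :
  lock_shape D N A -> row_nonempty D x = (0 < A x).
Proof.
move=> sD; have leN := shape_le sD x; apply/idP/idP; rewrite /row_nonempty.
  case: row_columns (mem_row_columns D x) => // c s /(_ c).
  by rewrite mem_head (shape_mem sD); lia.
move=> Ax; apply/eqP => row0; have := mem_row_columns D x N.
by rewrite row0 in_nil (shape_mem sD) leqnn andbT; lia.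
Qed.

Lemma row_le_height (D : diagram) N A x :
  lock_shape D N A -> 0 < A x -> x <= height D.
Proof.
move=> sD Ax; have leN := shape_le sD x.
suff xD : (x, N) \in D by exact: (leq_bigmax_seq (F := fst) (x, N) xD).
by rewrite (shape_mem sD) leqnn andbT; lia.
Qed.

Lemma bigmax_mem (s : seq nat) m :
  m \in s -> (forall c, c \in s -> c <= m) -> \max_(c <- s) c = m.
Proof.
move=> ms lem; apply/eqP; rewrite eqn_leq leq_bigmax_seq // andbT.
by apply/bigmax_leqP_seq => c /lem.
Qed.

(** Induction from the top row down: the columns marked so far are the last [clouds_above] ones, so
    the rightmost free cell of a right-justified row is the one just left of them. *)
Lemma mem_marked (D : diagram) N A (x : nat) : lock_shape D N A ->
  let h := height D in x <= h -> forall q : pos,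
  (q \in foldr (mark_row D) fset0 (iota x.+1 (h - x))) =
  [&& x < q.1 <= h, dark A h q.1 & q.2 == N - clouds_above A h q.1].
Proof.
move=> sD h; move mE: (h - x) => m; elim: m x mE => [|m IHm] x mE lexh q.
  by rewrite inE; case: q => a b /=; lia.
have ltxh : x < h by lia.
have {IHm} IHm := IHm x.+1 _ ltxh; set M := foldr _ _ (iota x.+2 m) in IHm *.
have {}IHm : forall q : pos, (q \in M) = _ := IHm ltac:(lia).
have hasM c : has (fun p : pos => (x.+1 < p.1) && (p.2 == c)) M
    = (N - clouds_above A h x.+1 < c <= N).
  have leN := clouds_above_le h x.+1 (shape_le sD).
  apply/hasP/idP => [[[a b]]|].
    rewrite IHm /= => /and3P[ah da /eqP->] /andP[xa /eqP<-].
    have := @clouds_above_lt A h x.+1 a ah da.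
    by have := shape_le sD a; move: da; rewrite /dark; lia.
  move=> cN.
  (* Going up, [clouds_above] falls to 0 by at most one per row, and only at dark rows. The row
     where column [c] leaves the marked interval is the witness. *)
  have [y [yh dy cy]] : exists y, [/\ x.+1 < y <= h, dark A h y &
      c = N - clouds_above A h y].
    move: ltxh cN; move: (x.+1) => z; move nE: (h - z) => n.
    elim: n z nE => [|n IHn] z nE zh cN.
      by move: cN; have ->: z = h by [lia]; rewrite clouds_above_top; lia.
    have zh' : z < h by lia.
    case: (boolP (N - clouds_above A h z.+1 < c)) => cz.
      have [||y [? ? ?]] := IHn z.+1 _ zh'; [lia | lia |].
      by exists y; split=> //; lia.
    exists z.+1; move: cN; rewrite (clouds_aboveS A zh').
    by case: dark => /= cN; split=> //; lia.
  by exists (y, c); rewrite ?IHm /= ?eqxx ?cy ?eqxx ?yh ?dy; lia.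
rewrite [foldr _ _ _]/= -/M /mark_row.
set cand := [seq c <- _ | _].
have mem_cand c : (c \in cand) = (N - A x.+1 < c <= N - clouds_above A h x.+1).
  rewrite mem_filter hasM mem_row_columns (shape_mem sD).
  by have := shape_le sD x.+1; lia.
have dq : [&& x < q.1 <= h, dark A h q.1 & q.2 == N - clouds_above A h q.1] =
    (q \in M) || [&& q.1 == x.+1, dark A h x.+1 & q.2 == N - clouds_above A h x.+1].
  rewrite IHm; case: (eqVneq q.1 x.+1) => [->|ne].
    by rewrite ltnn ltnSn ltxh.
  by rewrite orbF; congr andb; lia.
rewrite {}dq; case: (boolP (dark A h x.+1)) => dx; last first.
  case candE: cand => [|c s]; first by rewrite andbF orbF.
  by have := mem_head c s; rewrite -candE mem_cand; move: dx; rewrite /dark; lia.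
have mcand : N - clouds_above A h x.+1 \in cand.
  by rewrite mem_cand leqnn andbT; have := shape_le sD x.+1; move: dx; rewrite /dark; lia.
case candE: cand (mcand) => [//|c s] _; rewrite -candE.
rewrite (bigmax_mem mcand); last by move=> c'; rewrite mem_cand => /andP[].
by rewrite !inE orbC; case: (q) => a b; rewrite xpair_eqE.
Qed.

Lemma mem_dark_clouds (D : diagram) N A (q : pos) : lock_shape D N A ->
  (q \in dark_clouds (snow D)) =
  (q.1 \in dark_rows A (height D)) && (q.2 == N - clouds_above A (height D) q.1).
Proof.
move=> sD; rewrite [dark_clouds _]/= /mark_dark_clouds.
have := mem_marked sD (leq0n _) q; rewrite subn0 => ->.
by rewrite mem_filter mem_iota andbA [dark _ _ _ && _]andbC add1n ltnS.
Qed.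

(** A dark row contributes one flake for each empty row below it, and different dark rows use
    different columns. *)
Lemma card_snowflakes (D : diagram) N A : lock_shape D N A ->
  #|` snowflakes (snow_star D)| = dark_weight A (height D).
Proof.
move=> sD; set h := height D.
pose col x := N - clouds_above A h x.
pose rows x := [seq s <- iota 1 x.-1 | A s == 0].
pose flakes := [seq (s, col x) | x <- dark_rows A h, s <- rows x].
(* The truncated subtraction is injective here: a dark row has fewer than [N] clouds above it. *)
have col_inj : {in dark_rows A h &, injective col}.
  move=> x y; rewrite !mem_filter !mem_iota => /andP[dx xh] /andP[dy yh].
  rewrite /col => eqc; have lt_dark z : dark A h z -> clouds_above A h z < N.
    by move/leq_trans; apply; apply: shape_le sD z.
  have := lt_dark x dx; have := lt_dark y dy.
  case: (ltngtP x y) => // xy.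
    by have := @clouds_above_lt A h x y _ dy; lia.
  by have := @clouds_above_lt A h y x _ dx; lia.
have uniq_flakes : uniq flakes.
  apply: allpairs_uniq_dep => [|x _|].
  - by rewrite filter_uniq // iota_uniq.
  - by rewrite filter_uniq // iota_uniq.
  move=> _ _ /allpairsPdep[x [s [xd _ ->]]] /allpairsPdep[y [t [yd _ ->]]] /=.
  by case=> -> /col_inj->.
have -> : dark_weight A h = size flakes.
  rewrite size_allpairs_dep; congr sumn; apply/eq_in_map => x.
  rewrite mem_filter => /andP[dx _]; rewrite size_filter count_empty_rows //.
  exact: leq_ltn_trans dx.
apply: perm_size; apply: uniq_perm => // q; apply/idP/allpairsPdep.
  rewrite /snow_star /= /place_snowflakes !inE /=.
  case/andP=> /andP[/allpairsPdep[q' [s [q'M sq' ->]]] _] /= emp.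
  move: q'M; rewrite -[mark_dark_clouds D]/(dark_clouds (snow D)).
  rewrite (mem_dark_clouds _ sD) => /andP[q'd /eqP q'c].
  exists q'.1, s; split=> //; last by rewrite q'c.
  by rewrite mem_filter sq' andbT; move: emp; rewrite (row_nonempty_shape _ sD); lia.
case=> x [s [xd]]; rewrite mem_filter => /andP[/eqP As sx] ->.
rewrite /snow_star /= /place_snowflakes !inE /= (row_nonempty_shape _ sD) As.
rewrite (shape_mem sD) As andbT; apply/andP; split; last by lia.
apply/allpairsPdep; exists (x, col x), s; split=> //.
by rewrite -[mark_dark_clouds D]/(dark_clouds (snow D)) (mem_dark_clouds _ sD) xd /=.
Qed.

(** * The upper bound on the number of ghosts *)

Lemma rank_increase A x y : x <= y -> rank A x <= rank A y <= rank A x + (y - x).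
Proof.
elim: y => [|y IHy]; first by rewrite leqn0 => /eqP->; rewrite addn0 !leqnn.
rewrite leq_eqVlt => /predU1P[->|ltxy]; first by rewrite subnn addn0 !leqnn.
by have := IHy ltxy; rewrite rankS; case: (0 < A _); lia.
Qed.

(** Every nonempty row starts with a cell in column [N], and these cells stay in strictly increasing
    positive rows. *)
Lemma rank_le_label (D : diagram) N A E p l x : lock_shape D N A ->
  labelling D N E p l -> 0 < A x -> rank A x <= p x N.
Proof.
move=> sD lab Ax.
have inN y : 0 < A y -> (y, N) \in D.
  by have := shape_le sD y; rewrite (shape_mem sD) leqnn andbT; lia.
(* The bound [v] is arbitrary so that the induction can lower it by one at each nonempty row. *)
suff rank_bound y v : (forall z, 0 < z <= y -> 0 < A z -> p z N <= v) ->
    rank A y <= v.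
  apply: rank_bound => z /andP[_ lezx] Az.
  case: (ltngtP z x) lezx => // [ltzx _|-> //].
  exact: ltnW (label_lt lab (inN z Az) (inN x Ax) ltzx).
elim: y v => [|y IHy] v bnd //; rewrite rankS.
case: (ltnP 0 (A y.+1)) => Ay; last first.
  by rewrite addn0; apply: IHy => z zy; apply: bnd; lia.
have := label_bounds lab (inN _ Ay); have := bnd y.+1 _ Ay.
suff : rank A y <= v.-1 by lia.
apply: IHy => z zy Az.
have := label_lt lab (inN z Az) (inN y.+1 Ay); have := bnd y.+1 _ Ay; lia.
Qed.

(** The lower bound comes from [ghost_label] in column [N], where the label is at least at its
    rank. *)
Lemma ghost_row_bounds (D : diagram) N A E p l q : lock_shape D N A ->
  labelling D N E p l -> E.[? q] = Some Ghost ->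
  l q \in iota 1 (height D) /\ rank A (l q) < q.1 <= l q.
Proof.
case: q => s c sD lab Es; have [lD sl lts] := ghost_label lab Es.
have Al : 0 < A (l (s, c)) by move: lD; rewrite (shape_mem sD); lia.
have l0 : 0 < l (s, c) by case: (l _) Al; rewrite ?(shape_row0 sD).
rewrite mem_iota l0 add1n ltnS (row_le_height sD Al) sl /= andbT; split=> //.
apply: leq_ltn_trans (rank_le_label sD lab Al) (lts N _).
by move: lD; rewrite (shape_mem sD); lia.
Qed.

Definition has_ghost (E : diagram) (l : pos -> nat) (x s : nat) : bool :=
  has (fun q : pos => (l q == x) && (q.1 == s)) (enum_fset (ghosts E)).

Lemma has_ghostP (E : diagram) (l : pos -> nat) x s :
  reflect (exists2 c, E.[? (s, c)] = Some Ghost & l (s, c) = x)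
          (has_ghost E l x s).
Proof.
apply: (iffP hasP) => [[[s' c]]|[c Es <-]].
  by rewrite mem_ghosts => /eqP Es /= /andP[/eqP<- /eqP<-]; exists c.
by exists (s, c); rewrite ?mem_ghosts ?Es //= !eqxx.
Qed.

(* If every dark label above [x] had a ghost on the diagonal through [(x, s)],
   then [ghost_above] would push these ghosts strictly to the right at each
   step, past the last column. *)
Lemma diagonal_gap (D : diagram) N A E p l x s : let h := height D in
  lock_shape D N A -> labelling D N E p l ->
  has_ghost E l x s -> ~~ dark A h x ->
  (forall y, x < y <= h -> 0 < A y -> dark A h y) ->
  has (fun y => (x < y) && ~~ has_ghost E l y (s + rank A y - rank A x))
      (dark_rows A h).
Proof.
move=> h sD lab /has_ghostP[c Es lx] ndark dark_up.
have [xh srank] := ghost_row_bounds sD lab Es; rewrite lx /= in xh srank.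
rewrite -[has _ _]negbK; apply/negP => /hasPn full.
(* The diagonal ghost at [y] stays right of column [N - clouds_above A h y], which is [N] when
   [y = h]. It holds at [x] because [x] is not dark; empty rows keep the previous ghost, of label
   [y0]. *)
have chain y : x <= y <= h -> exists y0 c', [/\ y0 <= y,
    E.[? (s + rank A y - rank A x, c')] = Some Ghost,
    l (s + rank A y - rank A x, c') = y0 & N - clouds_above A h y < c'].
  elim: y => [|y IHy] xy.
    by move: xh; rewrite mem_iota; lia.
  have [eqxy|ltxy] := eqVneq x y.+1.
    exists x, c; rewrite -eqxy addnK; split=> //; move: ndark.
    have [lD _ _] := ghost_label lab Es; move: lD.
    by rewrite lx (shape_mem sD) /dark; lia.
  have {IHy} [|y0 [c' [y0y Ey ly cy]]] := IHy; first by lia.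
  have yh : y < h by lia.
  have rxy : rank A x <= rank A y by have := @rank_increase A x y; lia.
  move: cy; rewrite (clouds_aboveS A yh) rankS.
  case: (ltnP 0 (A y.+1)) => Ay; last first.
    have -> : dark A h y.+1 = false by rewrite /dark; lia.
    by rewrite !addn0 => cy; exists y0, c'; split=> //; lia.
  have dy : dark A h y.+1 by apply: dark_up => //; lia.
  rewrite dy => cy.
  have : has_ghost E l y.+1 (s + (rank A y + 1) - rank A x).
    have := full y.+1; rewrite mem_filter dy mem_iota rankS Ay /=.
    by move=> /(_ _)/nandP[||]; [lia | lia | rewrite negbK].
  case/has_ghostP => c2 Ey2 ly2; exists y.+1, c2; split=> //.
  have [l2D _ lt2] := ghost_label lab Ey2.
  have c'N : c' <= N.
    by have [+ _ _] := ghost_label lab Ey; rewrite (shape_mem sD); lia.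
  have yD : (y.+1, c') \in D.
    by rewrite (shape_mem sD); move: dy; rewrite /dark; lia.
  (* If [c2 <= c'], the cell of label [y.+1] in column [c'] would lie above the old ghost and below
     the row just over it. So [c' < c2], which pays for the extra cloud. *)
  have := ghost_above lab Ey yD; rewrite ly ltnS => /(_ y0y).
  case: (leqP c2 c') => c2c'; last by lia.
  by have := lt2 c'; rewrite ly2; lia.
have [|y0 [c' [_ Eh _]]] := chain h; first by move: xh; rewrite mem_iota; lia.
have [+ _ _] := ghost_label lab Eh.
by rewrite clouds_above_top (shape_mem sD); lia.
Qed.

Lemma card_ghosts_le (D : diagram) N A E : let h := height D in
  lock_shape D N A ->
  (forall x y, 0 < A x -> 0 < A y -> rank A x < x -> rank A y < y ->
     ~~ dark A h x -> ~~ dark A h y -> x = y) ->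
  KKD D E -> #|` ghosts E| <= dark_weight A h.
Proof.
move=> h sD uniq_bright DE; have [p [l lab]] := labelling_KKD sD DE.
pose Z := [seq (x, s) | x <- dark_rows A h, s <- iota (rank A x).+1 (x - rank A x)].
have -> : dark_weight A h = size Z.
  by rewrite size_allpairs_dep; congr sumn; apply: eq_map => x; rewrite size_iota.
have memZ x s : x \in dark_rows A h -> rank A x < s <= x -> (x, s) \in Z.
  move=> xd sx; apply/allpairsPdep; exists x, s; split=> //.
  by rewrite mem_iota; have := rank_le A x; lia.
pose gaps x s := [seq y <- dark_rows A h |
  (x < y) && ~~ has_ghost E l y (s + rank A y - rank A x)].
(* The default 0 is never reached for a ghost with a label that is not dark: [gapP] shows the list
   nonempty. *)
pose gap x s := head 0 (gaps x s).
(* Ghosts with a dark label keep their pair; the others slide along the diagonal to the first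
   gap. *)
pose phi (q : pos) := if dark A h (l q) then (l q, q.1)
  else (gap (l q) q.1, q.1 + rank A (gap (l q) q.1) - rank A (l q)).
have ghost_q q : q \in ghosts E -> [/\ E.[? q] = Some Ghost, 0 < l q <= h,
    rank A (l q) < q.1 <= l q, 0 < A (l q) & has_ghost E l (l q) q.1].
  rewrite mem_ghosts => /eqP Eq; have [] := ghost_row_bounds sD lab Eq.
  rewrite mem_iota add1n ltnS => lh rq; split=> //.
    by case: (q) Eq => s c /(ghost_label lab)[+ _ _]; rewrite (shape_mem sD); lia.
  by apply/has_ghostP; case: (q) Eq => s c Eq; exists c.
have gapP q : q \in ghosts E -> ~~ dark A h (l q) ->
    [/\ gap (l q) q.1 \in dark_rows A h, l q < gap (l q) q.1 &
     ~~ has_ghost E l (gap (l q) q.1)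
          (q.1 + rank A (gap (l q) q.1) - rank A (l q))].
  move=> /ghost_q[Eq lh rq Al ghq] ndark.
  have : gap (l q) q.1 \in gaps (l q) q.1.
    have : has predT (gaps (l q) q.1).
      rewrite has_filter filter_predT -has_filter.
      apply: (diagonal_gap sD lab ghq ndark) => y yh Ay.
      (* Since [rank A y] grows by at most [y - l q], a second label [y] that is not dark would also
         exceed its rank, contradicting uniqueness. *)
      apply/negPn/negP => ny; have := uniq_bright (l q) y Al Ay _ _ ndark ny.
      by have := @rank_increase A (l q) y; lia.
    by rewrite /gap; case: (gaps _ _) => // y s _; apply: mem_head.
  by rewrite mem_filter => /andP[/andP[]].
rewrite -(size_map phi); apply: uniq_leq_size.
  rewrite map_inj_in_uniq ?fset_uniq // => q1 q2 g1 g2.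
  have [E1 l1 r1 A1 h1] := ghost_q _ g1; have [E2 l2 r2 A2 h2] := ghost_q _ g2.
  have same : l q1 = l q2 -> q1.1 = q2.1 -> q1 = q2.
    case: (q1) E1 => s1 c1 E1; case: (q2) E2 => s2 c2 E2 /= + eqs.
    by rewrite eqs in E1 * => /(ghost_inj lab E1 E2)->.
  rewrite /phi; case: ifPn => d1; case: ifPn => d2.
  - by case.
  (* A kept pair carries a ghost and a gap does not, so the two kinds of image never meet. *)
  - by case=> e1 e2; have [_ _] := gapP _ g2 d2; rewrite -e2 -e1 h1.
  - by case=> e1 e2; have [_ _] := gapP _ g1 d1; rewrite e2 e1 h2.
  have eql : l q1 = l q2 by apply: uniq_bright => //; lia.
  case=> e1 e2; apply: same => //; move: e2; rewrite -e1 -eql.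
  have [_ ltl _] := gapP _ g1 d1.
  have /andP[+ _] := @rank_increase A _ _ (ltnW ltl).
  move: (rank A (gap _ _)) (rank A (l q1)) => a b leba.
  by rewrite -!addnBA // => /addIn.
move=> _ /mapP[q qE ->]; have [_ lh rq _ _] := ghost_q q qE; rewrite /phi.
case: ifPn => dq; first by apply: memZ; rewrite // mem_filter dq mem_iota; lia.
(* The slide raises the row by the increase in rank, which is at most the increase in label, so both
   bounds persist. *)
have [gd lg _] := gapP q qE dq; apply: memZ => //.
move: (gap _ _) lg => y lg; have := @rank_increase A _ _ (ltnW lg).
by move: (q.1) (l q) rq lg => s x; lia.
Qed.

(** * Lowering rows to attain the bound *)

Lemma down_move (D E : diagram) s c (g : bool) : KKD D E -> 0 < s ->
  E.[? (s.+1, c)] = Some Ordinary ->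
  (forall c', c < c' -> E.[? (s.+1, c')] = None) -> E.[? (s, c)] = None ->
  exists F, [/\ KKD D F, after_move E F s.+1 c s g
    & #|` ghosts F| = #|` ghosts E| + g].
Proof.
move=> DE s0 Es right0 Es0.
have mv : can_move E s.+1 c s.
  split; rewrite ?Es //; try by move=> t; lia.
    split=> [|c']; rewrite mem_lookup ?Es //.
    by case: (leqP c' c) => // /right0->.
  by split; rewrite ?s0 ?mem_lookup ?Es0 //= => t; lia.
have neq : ((s, c) == (s.+1, c)) = false by rewrite xpair_eqE; lia.
case: g.
  exists (E.[(s.+1, c) <- Ghost]).[(s, c) <- Ordinary]; split.
  - exact: KKD_step DE (Ghost_move mv).
  - by move=> q; rewrite !fnd_set.
  have -> : ghosts (E.[(s.+1, c) <- Ghost]).[(s, c) <- Ordinary]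
      = (s.+1, c) |` ghosts E.
    apply/fsetP => q; rewrite in_fset1U !mem_ghosts !fnd_set.
    case: (eqVneq q (s, c)) => [->|_]; first by rewrite neq Es0.
    by case: (eqVneq q (s.+1, c)) => [->|_] /=; rewrite ?eqxx.
  by rewrite cardfsU1 mem_ghosts Es addnC.
exists (E.[~ (s.+1, c)]).[(s, c) <- Ordinary]; split.
- exact: KKD_step DE (Kohnert_move mv).
- by move=> q; rewrite fnd_set fnd_rem1; case: eqP => //; case: eqP.
rewrite addn0; congr #|` _|; apply/fsetP => q.
rewrite !mem_ghosts fnd_set fnd_rem1.
case: (eqVneq q (s, c)) => [->|_]; first by rewrite Es0.
by case: (eqVneq q (s.+1, c)) => [->|_] //=; rewrite Es.
Qed.

(** The cells are dropped from right to left, so that each is rightmost in its row when it moves. *)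
Lemma clear_row (D E : diagram) N L s : KKD D E -> 0 < s -> L <= N ->
  (forall c, N < c -> E.[? (s.+1, c)] = None) ->
  (forall c, L < c -> E.[? (s.+1, c)] <> Some Ghost) ->
  (forall c, L < c -> E.[? (s, c)] = None) ->
  exists F, [/\ KKD D F, #|` ghosts F| = #|` ghosts E|
    & forall t c, F.[? (t, c)] = if c <= L then E.[? (t, c)] else
      if t == s.+1 then None else
      if t == s then E.[? (s.+1, c)] else E.[? (t, c)]].
Proof.
move=> DE s0; move mE: (N - L) => m; elim: m L mE => [|m IHm] L mE LN EN EL Es.
  exists E; split=> // t c; case: leqP => // Lc.
  have E0 : E.[? (s.+1, c)] = None by apply: EN; lia.
  by case: eqP => [->|_]; [rewrite E0 | case: eqP => // ->; rewrite E0 Es].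
have [|||c Lc|c Lc|F [DF gF FE]] := IHm L.+1; [lia | lia | done
  | by apply: EL; lia | by apply: Es; lia |].
have F1 : F.[? (s.+1, L.+1)] = E.[? (s.+1, L.+1)] by rewrite FE leqnn.
case E1: (E.[? (s.+1, L.+1)]) => [x|]; last first.
  exists F; split=> // t c; rewrite FE.
  case: (ltngtP c L.+1) => cL; first by rewrite (_ : c <= L); [|lia].
    by rewrite (_ : (c <= L) = false); [|lia].
  rewrite cL ltnn; case: eqP => [->|_]; first by rewrite E1.
  by case: eqP => // ->; rewrite E1 Es.
have xO : x = Ordinary by case: x E1 => // /EL; case.
have [|c' Lc'||G [DG GF gG]] := @down_move D F s L.+1 false DF s0.
- by rewrite F1 E1 xO.
- by rewrite FE leqNgt Lc' eqxx.
- by rewrite FE leqnn Es.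
exists G; split=> // [|t c]; first by rewrite gG addn0.
rewrite GF FE !xpair_eqE; case: (ltngtP c L.+1) => cL.
- by rewrite !andbF (_ : c <= L); [|lia].
- by rewrite !andbF (_ : (c <= L) = false); [|lia].
rewrite cL ltnn !andbT; case: (eqVneq t s) => [->|ts]; last by [].
by rewrite E1 xO (_ : (s == s.+1) = false); [|lia].
Qed.

(** Each step drops the cells right of column [L] by one row and then, if [b], makes a ghost move in
    column [L]. The condition [L < c + b] includes column [L] exactly when [b] holds. *)
Lemma lower_row (D E : diagram) N L k s (b : bool) : KKD D E -> L <= N ->
  k < s ->
  (forall c, N < c -> E.[? (s, c)] = None) ->
  (forall c, L < c -> E.[? (s, c)] <> Some Ghost) ->
  (b -> E.[? (s, L)] = Some Ordinary) ->
  (forall t c, k < t < s -> L < c + b -> E.[? (t, c)] = None) ->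
  exists F, [/\ KKD D F, #|` ghosts F| = #|` ghosts E| + b * (s - k.+1),
    forall t c, s < t -> F.[? (t, c)] = E.[? (t, c)]
    & forall t c, k.+1 < t <= s -> L < c -> F.[? (t, c)] = None].
Proof.
move=> DE LN; elim: s E DE => // s IHs E DE; rewrite ltnS leq_eqVlt.
case/predU1P=> [<- *|ks EN EL Eb E0].
  by exists E; split=> [|||t c]; rewrite ?subnn ?muln0 ?addn0 //; lia.
have [|c Lc|F [DF gF FE]] := clear_row DE _ LN EN EL; [lia | |].
  by apply: E0; lia.
(* [G] is [F] after the optional ghost move, which outside row [s.+1] affects only [(s, L)]. *)
have [G [DG gG GF Gb]] : exists G, [/\ KKD D G, #|` ghosts G| = #|` ghosts F| + b,
    forall t c, t != s.+1 -> (b -> c <> L \/ t <> s) -> G.[? (t, c)] = F.[? (t, c)]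
    & (forall c, L < c -> G.[? (s.+1, c)] = None) /\
      (b -> G.[? (s, L)] = Some Ordinary)].
  case: (b) Eb E0 => [/(_ isT) Es|_] E0; last first.
    exists F; rewrite addn0; split=> //; split=> // c Lc.
    by rewrite FE leqNgt Lc eqxx.
  have [||c' Lc'||G [DG GF gG]] := @down_move D F s L true DF.
  - by lia.
  - by rewrite FE leqnn.
  - by rewrite FE leqNgt Lc' eqxx.
  - by rewrite FE leqnn E0 //; lia.
  exists G; split=> // [t c ts ne|]; last split=> [c Lc|_].
  - rewrite GF !xpair_eqE (negPf ts) /=.
    by case: eqP => //= ?; case: eqP => //= ?; case: ne.
  - by rewrite GF FE !xpair_eqE eqxx leqNgt Lc (gtn_eqF Lc) !andbF.
  - by rewrite GF eqxx.
have Gs c : L < c -> G.[? (s, c)] = E.[? (s.+1, c)].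
  move=> Lc; rewrite GF ?FE; [|lia|by left; lia].
  by rewrite leqNgt Lc eqxx (_ : (s == s.+1) = false); [|lia].
have [|||t c ts Lc|H [DH gH HG H0]] := IHs G DG ks.
- by move=> c Nc; rewrite Gs ?EN //; lia.
- by move=> c Lc; rewrite Gs //; apply: EL.
- exact: (proj2 Gb).
- rewrite GF ?FE; [|lia|by right; lia].
  have Et : E.[? (t, c)] = None by apply: E0; lia.
  have [ts1 ts2] : t == s.+1 = false /\ t == s = false by lia.
  by rewrite ts1 ts2 Et if_same.
exists H; split=> // [|t c st|t c kt Lc].
- by rewrite gH gG gF -addnA -mulnS -subSn.
- rewrite HG ?GF ?FE; [|lia|by right; lia|lia].
  have [ts1 ts2] : t == s.+1 = false /\ t == s = false by lia.
  by rewrite ts1 ts2 if_same.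
case: (eqVneq t s.+1) => [->|ts]; last by apply: H0; lia.
by rewrite HG ?ltnS //; apply: (proj1 Gb).
Qed.

(* Rows are lowered bottom up, row [x] one step at a time to row [rank A x];
   a dark row leaves a ghost in its dark cloud's column at each step, and the
   cells to the left of that column stay behind. *)
Lemma exists_dark_weight (D : diagram) N A : let h := height D in
  lock_shape D N A ->
  exists2 E, KKD D E & #|` ghosts E| = dark_weight A h.
Proof.
move=> h sD.
have D0 s c : ~~ (N - A s < c <= N) -> D.[? (s, c)] = None.
  by rewrite -(shape_mem sD) mem_lookup negbK => /eqP.
(* Invariant: rows above [x] are untouched, and those between [rank A x] and [x] are free in every
   column that the next row needs. *)
suff lower x : x <= h -> exists E, [/\ KKD D E,
    #|` ghosts E| = sumn [seq y - rank A y | y <- iota 1 x & dark A h y],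
    forall s c, x < s -> E.[? (s, c)] = D.[? (s, c)]
    & forall s c, rank A x < s <= x -> N - clouds_above A h x < c ->
        E.[? (s, c)] = None].
  by have [E [DE gE _ _]] := lower h (leqnn h); exists E.
elim: x => [_|x IHx xh].
  exists D; split=> [|||s c]; [exact: KKD_refl | | by [] | by lia].
  apply/eqP; rewrite cardfs_eq0; apply/eqP/fsetP => q; rewrite mem_ghosts inE.
  by apply/eqP; apply: shape_ordinary sD _.
have {IHx} [E [DE gE ED E0]] := IHx (ltnW xh).
have -> : sumn [seq y - rank A y | y <- iota 1 x.+1 & dark A h y] =
    #|` ghosts E| + dark A h x.+1 * (x.+1 - rank A x.+1).
  rewrite gE -(addn1 x) iotaD filter_cat map_cat sumn_cat addn1 add1n /=.
  by case: dark; rewrite /= ?mul1n ?addn0.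
move: E0; rewrite (clouds_aboveS A xh) rankS => E0.
have leN := clouds_above_le h x (shape_le sD).
rewrite (clouds_aboveS A xh) in leN.
case: (ltnP 0 (A x.+1)) => Ax; last first.
  have nd : dark A h x.+1 = false by rewrite /dark; lia.
  rewrite nd addn0 in E0; exists E; split=> // [|s c xs|s c].
  - by rewrite nd addn0.
  - by apply: ED; lia.
  rewrite addn0 => /andP[rs]; rewrite leq_eqVlt => /predU1P[-> _|sx].
    by rewrite ED // D0 //; lia.
  by apply: E0; lia.
(* For a dark row this is its cloud's column. The invariant at [x] then frees column [L] as well,
   because [clouds_above] is larger by one at [x]. *)
pose L := N - clouds_above A h x.+1.
have Drow c : E.[? (x.+1, c)] = D.[? (x.+1, c)] by apply: ED.
have [||c Nc|c _|d|t c tx Lc|F [DF gF FE F0]] :=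
  @lower_row D E N L (rank A x) x.+1 (dark A h x.+1) DE.
- by rewrite /L; lia.
- by have := rank_le A x; lia.
- by rewrite Drow D0 //; lia.
- by rewrite Drow; apply: shape_ordinary sD _.
- rewrite Drow; apply: lookup_ordinary (shape_ordinary sD (q := _)).
  by rewrite (shape_mem sD) /L; have := shape_le sD x.+1; move: d; rewrite /dark; lia.
- by apply: E0; [lia | move: Lc; rewrite /L; lia].
exists F; split=> // [|s c xs|s c].
- by rewrite gF addn1.
- by rewrite FE // ED //; lia.
by rewrite addn1 => ? ?; apply: F0.
Qed.

(** * Ranks as indices of nonempty rows, and the conclusion *)

Lemma rank_nth A (r : seq nat) k : A 0 = 0 -> sorted ltn r ->
  (forall x, (x \in r) = (0 < A x)) -> k < size r ->
  rank A (nth 0 r k) = k.+1.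
Proof.
move=> A0 sr memr kr; have nth_lt := sorted_ltn_nth ltn_trans 0 sr.
rewrite /rank -size_filter; set s := filter _ _.
(* Both lists are strictly increasing with the same members; [A 0 = 0] keeps row 0, which [rank]
   does not count, out of [r]. *)
suff -> : s = take k.+1 r by rewrite size_takel.
apply: (irr_sorted_eq ltn_trans ltnn) => [||y].
- by rewrite sorted_filter ?iota_ltn_sorted //; exact: ltn_trans.
- exact: take_sorted.
rewrite mem_filter mem_iota -memr; case: (boolP (y \in r)) => [yr|yr] /=; last first.
  by apply/esym/negP => /mem_take yr'; rewrite yr' in yr.
have y0 : 0 < y by case: y yr => //; rewrite memr A0.
have ir : index y r < size r by rewrite index_mem.
rewrite in_take // y0 add1n !ltnS -[in LHS](nth_index 0 yr).
case: (ltngtP (index y r) k) => [ik|ki|->]; last by rewrite leqnn.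
  exact/ltnW/nth_lt.
by apply/negbTE; rewrite -ltnNge; apply: nth_lt.
Qed.

(* r lists the nonempty rows r_1 < ... < r_n; tnth r k is r_(k+1). *)
Theorem theorem3p17 (D : diagram) (n : nat) (r : n.-tuple nat)
    (HD : is_lock D)
    (Hsorted : sorted ltn r)
    (Hrows : forall i : nat, (i \in r) = row_nonempty D i)
    (Hk : #|[set k : 'I_n | (k.+1 < tnth r k)%N &
               ~~ has (fun p : pos => p.1 == tnth r k)
                      (dark_clouds (snow D))]| <= 1) :
  is_MaxG D #|` snowflakes (snow_star D) |%fset.
Proof.
have [N [A sD]] := lock_shapeP HD.
have memr x : (x \in (r : seq nat)) = (0 < A x).
  by rewrite Hrows (row_nonempty_shape _ sD).
rewrite (card_snowflakes sD); split; first exact: exists_dark_weight sD.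
move=> E; apply: (card_ghosts_le sD) => x y Ax Ay rx ry dx dy.
(* The index of [z] in [r], counted from 1, is [rank A z], so such labels correspond to the indices
   counted in [Hk]. *)
have bright z : 0 < A z -> rank A z < z -> ~~ dark A (height D) z ->
    exists2 k : 'I_n, tnth r k = z & k \in [set k : 'I_n | (k.+1 < tnth r k)%N &
      ~~ has (fun p : pos => p.1 == tnth r k) (dark_clouds (snow D))].
  move=> Az rz dz; have /tnthP[k zk] : z \in r by rewrite memr.
  exists k => //; rewrite inE -zk; apply/andP; split.
    rewrite -(rank_nth (shape_row0 sD) Hsorted memr (k := k)) ?size_tuple //.
    by rewrite -(tnth_nth 0) -zk.
  apply/hasPn => q; rewrite (mem_dark_clouds _ sD) mem_filter.
  by case/andP=> /andP[dq _] _; apply: contraNneq dz => <-.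
have [i <- iB] := bright x Ax rx dx; have [j <- jB] := bright y Ay ry dy.
by congr tnth; apply: (card_le1_eqP Hk).
Qed.
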